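(* Let $\mathcal X=\{\mathbf x_1,\dots,\mathbf x_N\}$ be a Cartesian grid on $\mathcal D=[a,b]\times[c,d]$, covered by overlapping local Cartesian subgrids $\mathcal X_1,\dots,\mathcal X_M$ of size $n_x\times n_y$, let $B_1,\dots,B_N$ be the associated global basis functions, and let $\mathcal G[\cdot,\mathcal X]$ be the associated global operator (all as defined in the context). Then: (i) the global basis functions satisfy the cardinal property $$B_i(\mathbf x_j)=\delta_{ij},\qquad i,j=1,\dots,N;$$ (ii) for every function $u:\mathcal D\to\mathbb R$ with nodal values $u_j=u(\mathbf x_j)$, the operator $\mathcal G$ interpolates the nodal data: $$\mathcal G[u,\mathcal X](\mathbf x_j)=u_j,\qquad j=1,\dots,N.$$
   Context: Grid. $\mathcal X=\{\mathbf x_{i,j}=(x_i,y_j):1\le i\le N_x,\ 1\le j\le N_y\}$ with $a=x_1<\dots<x_{N_x}=b$ and $c=y_1<\dots<y_{N_y}=d$; $N=N_xN_y$. Nodes are renumbered by a single index $\lambda=(i-1)N_y+j$, so $\mathcal X=\{\mathbf x_1,\dots,\mathbf x_N\}$. Subgrids. Fix $2\le n_x\le N_x$, $2\le n_y\le N_y$ and steps $1\le\rho_x\le n_x-1$, $1\le\rho_y\le n_y-1$. The starting indices $i_1<\dots<i_{M_x}$ and $j_1<\dots<j_{M_y}$ satisfy $i_{p+1}=i_p+\rho_x$, $j_{q+1}=j_q+\rho_y$, $i_p+n_x-1\le N_x$, $j_q+n_y-1\le N_y$. The subgrids are $\{(x_{i_p+r},y_{j_q+s}):0\le r\le n_x-1,\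 0\le s\le n_y-1\}$, for $1\le p\le M_x$, $1\le q\le M_y$, numbered as $\mathcal X_1,\dots,\mathcal X_M$ with $M=M_xM_y$. Adjacent subgrids thus overlap (share grid nodes), and it is assumed that $\bigcup_{k=1}^M\mathcal X_k=\mathcal X$. Local basis. Write $\mathcal X_k=\{(x_r^k,y_s^k):1\le r\le n_x,1\le s\le n_y\}$ and let $\ell_{x,r}^k,\ell_{y,s}^k$ be the one-dimensional Lagrange basis polynomials for the nodes $\{x_r^k\}_r$ and $\{y_s^k\}_s$. If $\mathbf x_\lambda=(x_r^k,y_s^k)\in\mathcal X_k$, put $\Phi_\lambda^k(x,y)=\ell_{x,r}^k(x)\,\ell_{y,s}^k(y)$. Weights. Fix $\mu>2$ and set $$\mathcal W_k(\mathbf x)=\frac{\omega_k(\mathbf x)}{\sum_{l=1}^M\omega_l(\mathbf x)},\qquad \omega_k(\mathbf x)=\prod_{\mathbf x'\in\mathcal X_k}\|\mathbf x-\mathbf x'\|^{-\mu}$$ (Euclidean norm), extended to the nodes by continuity; equivalently, for all $\mathbf x\in\mathbb R^2$, $$\mathcal W_k(\mathbf x)=\frac{\prod_{\mathbf x'\in\mathcal X\setminus\mathcal X_k}\|\mathbf x-\mathbf x'\|^{\mu}}{\sum_{l=1}^M\prod_{\mathbf x'\in\mathcal X\setminus\mathcal X_l}\|\mathbf x-\mathbf x'\|^{\mu}}.$$ Global basis functions and operator. With $K_\lambda=\{k:\mathbf x_\lambda\in\mathcal X_k\}$, $$B_\lambda(\mathbf x)=\sum_{k\in K_\lambda}\Phi_\lambda^k(\mathbf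 x)\,\mathcal W_k(\mathbf x),\qquad \mathcal G[u,\mathcal X](\mathbf x)=\sum_{\lambda=1}^N u_\lambda B_\lambda(\mathbf x),$$ where $u_\lambda=u(\mathbf x_\lambda)$. Here $\delta_{ij}$ is the Kronecker delta. *)

(* Defs.v *)
(* MathComp / MathComp-Analysis. *)
From HB Require Import structures.
From mathcomp Require Import all_boot all_order all_algebra.
From mathcomp Require Import all_classical all_reals all_analysis.

Set Implicit Arguments.
Unset Strict Implicit.
Unset Printing Implicit Defensive.

Import Order.TTheory GRing.Theory Num.Theory.
Import numFieldNormedType.Exports.

Local Open Scope classical_set_scope.
Local Open Scope ring_scope.

(* The library norm on R * R is the sup norm, hence this one. *)
Definition euclid_norm (R : realType) (z : R * R) : R :=
  Num.sqrt (z.1 ^+ 2 + z.2 ^+ 2).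

(* All indices start at 0: the coordinates are xs`_0 < ... < xs`_Nx.-1, and
   the single index (i - 1) Ny + j of the 1-based node (i, j) becomes
   i * Ny + j, which is undone by quotient and remainder. *)
Section Grid.
Variables (R : realType) (Nx Ny : nat) (xs : Nx.-tuple R) (ys : Ny.-tuple R).

Definition grid : seq (R * R) := [seq (x, y) | x <- xs, y <- ys].

Definition node (lam : 'I_(Nx * Ny)) : R * R :=
  (xs`_(lam %/ Ny), ys`_(lam %% Ny)).

(* ix and jy list the (0-based) indices in xs and ys at which the subgrids
   start; the subgrid starting at the p-th of ix and the q-th of jy has
   index k = p * My + q. *)
Section Cover.
Variables (nx ny Mx My : nat) (ix : Mx.-tuple nat) (jy : My.-tuple nat).
Implicit Types k : 'I_(Mx * My).

Definition local_x k (r : nat) : R := xs`_(nth 0%N ix (k %/ My) + r).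
Definition local_y k (s : nat) : R := ys`_(nth 0%N jy (k %% My) + s).

Definition subgrid k : seq (R * R) :=
  [seq (x, y) | x <- mkseq (local_x k) nx, y <- mkseq (local_y k) ny].

(* The pair (r, s) such that node lam is the local node (r, s) of subgrid k is
   unique when the coordinates are distinct. The value 0 is a placeholder for
   a node outside subgrid k, and it never enters global_basis.
   The tuple lagrange n x depends on x 0, ..., x n.-1 only. *)
Definition local_basis k (lam : 'I_(Nx * Ny)) (z : R * R) : R :=
  if [pick rs : 'I_nx * 'I_ny | node lam == (local_x k rs.1, local_y k rs.2)]
     is Some rs
  then (tnth (lagrange nx (local_x k)) rs.1).[z.1] *
       (tnth (lagrange ny (local_y k)) rs.2).[z.2]
  else 0.

Variable mu : R.

(* The points of subgrid k are pairwise distinct when the coordinates are, so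
   that the product over this sequence is the product over the set. *)
Definition omega k (z : R * R) : R :=
  \prod_(w <- subgrid k) euclid_norm (z - w) `^ (- mu).

Definition omega_ratio k (z : R * R) : R :=
  omega k z / \sum_(l < Mx * My) omega l z.

(* Extension of omega_ratio to the nodes by continuity. *)
Definition weight k (z : R * R) : R :=
  if z \in grid then lim (omega_ratio k w @[w --> z^'])
  else omega_ratio k z.

Definition global_basis (lam : 'I_(Nx * Ny)) (z : R * R) : R :=
  \sum_(k < Mx * My | node lam \in subgrid k) local_basis k lam z * weight k z.

Definition global_operator (u : R * R -> R) (z : R * R) : R :=
  \sum_(lam < Nx * Ny) u (node lam) * global_basis lam z.

End Cover.
End Grid.

(* Main.v *)
(* Off the grid, multiplying numerator and denominator of the weight W_k by
   prod_(w in X) |z - w|^mu turns it into g_k / sum_l g_l, where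
   g_k z = prod_(w in X, w not in X_k) |z - w|^mu is continuous. At a node the
   sum is positive because some subgrid contains the node, so the limit
   defining W_k there is g_k / sum_l g_l again: it vanishes when the node lies
   outside X_k, and the weights sum to 1. Inside X_k the local Lagrange basis is
   cardinal, so B_i(x_j) = delta_ij sum_k W_k(x_j) = delta_ij. *)
Require Import Defs.
From HB Require Import structures.
From mathcomp Require Import all_boot all_order all_algebra.
From mathcomp Require Import all_classical all_reals all_analysis.

Set Implicit Arguments.
Unset Strict Implicit.
Unset Printing Implicit Defensive.

Import Order.TTheory GRing.Theory Num.Theory.
Local Open Scope ring_scope.

Import numFieldNormedType.Exports.
Local Open Scope classical_set_scope.

(* The library's [lagrange_sample] asks for injectivity on all of [nat]. *)
Lemma lagrange_sample_in (K : fieldType) (n : nat) (x : nat -> K) :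
  {in [pred i | (i < n)%N] &, injective x} ->
  forall i j : 'I_n, (tnth (lagrange n x) i).[x j] = (i == j)%:R.
Proof.
move=> x_inj i j; rewrite [lagrange _ _]unlock tnth_map tnth_ord_tuple.
set p := \prod_(k < n | k != i) ('X - (x k)%:P).
(* The entries of [lagrange] are truncated to size at most [n]; this bound, passed on to the scaled
   product, makes the truncation the identity. *)
have size_p : (size p <= n)%N.
  rewrite /p size_prod => [|k _]; last by rewrite polyXsubC_eq0.
  rewrite (eq_bigr (fun=> (2 * 1)%N)) => [|k _]; last by rewrite size_XsubC.
  rewrite -big_distrr /= sum1_card cardC1 card_ord.
  by case: n i {j x x_inj p} => [[]//|n] _; rewrite mul2n -addnn -addSn addnK.
have size_q : (size ((p.[x i]^-1)%:P * p)%R <= n)%N.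
  by rewrite mul_polyC (leq_trans (size_scale_leq _ _)).
rewrite [val _]npolypK // hornerM hornerC; have [<-|neq_ij] := eqVneq.
  rewrite mulVf // horner_prod; apply/prodf_neq0 => k neq_ki.
  rewrite hornerXsubC subr_eq0; apply: contra_neqN neq_ki => /eqP.
  by move=> /(x_inj i k (ltn_ord i) (ltn_ord k)) /val_inj.
suff -> : p.[x j] = 0 by rewrite mulr0.
rewrite horner_prod (bigD1 j) /=; last by rewrite eq_sym.
by rewrite hornerXsubC subrr mul0r.
Qed.

(** * Powers of the Euclidean distance and punctured neighbourhoods in the plane *)

Section EuclidNorm.
Variable R : realType.
Implicit Types z w : R * R.

(** The absolute value keeps the base out of the negative reals, where a real power has only a
    conventional value. Away from 0 differentiability gives continuity; at 0 a direct estimate is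
    used. *)
Lemma powR_norm_continuous (r : R) :
  0 < r -> continuous (fun t : R => `|t| `^ r).
Proof.
move=> r_gt0 t; have [->|t_neq0] := eqVneq t 0; last first.
  apply: (@continuous_comp _ _ _ (fun t : R => `|t|) (fun t => t `^ r)).
    exact: norm_continuous.
  apply/differentiable_continuous/derivable1_diffP/derivable_powR.
  by rewrite in_itv /= andbT normr_gt0.
rewrite /continuous_at normr0 powR0 ?gt_eqF //.
apply/cvgrPdist_lt => e e_gt0.
near=> u; rewrite sub0r normrN ger0_norm ?powR_ge0 //.
have -> : e = (e `^ r^-1) `^ r.
  by rewrite -powRrM mulVf ?gt_eqF // powRr1 // ltW.
rewrite gt0_ltr_powR // ?nnegrE ?powR_ge0 //.
by near: u; apply: cvgr0_norm_lt; [exact: cvg_id|rewrite powR_gt0].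
Unshelve. all: by end_near. Qed.

Lemma euclid_norm_ge0 z : 0 <= euclid_norm z.
Proof. exact: sqrtr_ge0. Qed.

Lemma euclid_norm_eq0 z : (euclid_norm z == 0) = (z == 0).
Proof.
rewrite /euclid_norm sqrtr_eq0 le_eqVlt ltNge addr_ge0 ?sqr_ge0 //= orbF.
by rewrite paddr_eq0 ?sqr_ge0 // !sqrf_eq0; case: z.
Qed.

Lemma euclid_norm_continuous : continuous (@euclid_norm R).
Proof.
move=> z; apply: (@continuous_comp _ _ _ (fun z => z.1 ^+ 2 + z.2 ^+ 2)).
  apply: cvgD; rewrite !expr2; apply: cvgM;
    by [apply: cvg_fst|apply: cvg_snd].
exact: sqrt_continuous.
Qed.

Lemma euclid_dist_powR_continuous (r : R) w :
  0 < r -> continuous (fun z => euclid_norm (z - w) `^ r).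
Proof.
move=> r_gt0 z.
have -> : (fun z => euclid_norm (z - w) `^ r) =
    (fun t : R => `|t| `^ r) \o (fun z => euclid_norm (z - w)).
  by apply/funext => u /=; rewrite ger0_norm ?euclid_norm_ge0.
apply: continuous_comp; last exact: powR_norm_continuous.
apply: (@continuous_comp _ _ _ (fun z => z - w)).
  by apply: cvgB; [exact: cvg_id|exact: cvg_cst].
exact: euclid_norm_continuous.
Qed.

Lemma euclid_dist_powR_neq0 (r : R) z w :
  z != w -> euclid_norm (z - w) `^ r != 0.
Proof. by move=> zw; rewrite powR_eq0 euclid_norm_eq0 subr_eq0 (negPf zw). Qed.

(** Moving only the first coordinate leaves [z] inside any product neighbourhood, since the line has
    no isolated point. Properness makes limits at [z^'] unique. *)
Lemma dnbhs_pair_proper_filter z : ProperFilter z^'.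
Proof.
apply: Build_ProperFilter_ex => A [[U V] /= [Uz Vz] UVA].
have [t [Ut tz]] : exists t, U t /\ t != z.1.
  apply/(@filter_ex _ _ (Proper_dnbhs_numFieldType z.1))/filterI.
    exact: nbhs_dnbhs Uz.
  exact: (nbhs_dnbhs_neq (z.1 : R)).
exists (t, z.2); apply: UVA => /=; first by split => //; exact: nbhs_singleton.
by apply: contra_neq tz => <-.
Qed.

Lemma near_dnbhs_notin (s : seq (R * R)) z :
  \forall w \near z^', w \notin s.
Proof.
elim: s => [|y s IHs]; first by near=> w.
have near_y : \forall w \near z^', w != y.
  have [->|zy] := eqVneq y z; first exact: nbhs_dnbhs_neq.
  (* Exponent 1 stands for the plain distance, so the lemmas on powers apply; being nonzero at [z],
     it stays nonzero nearby. *)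
  have dist_neq0 : euclid_norm (z - y) `^ 1 != 0.
    by apply: euclid_dist_powR_neq0; rewrite eq_sym.
  apply: nbhs_dnbhs.
  have dist_cvg :
      euclid_norm (w - y) `^ 1 @[w --> z] --> euclid_norm (z - y) `^ 1.
    exact: euclid_dist_powR_continuous.
  near=> w; have : euclid_norm (w - y) `^ 1 != 0.
    by near: w; exact: cvgr_neq0 dist_cvg dist_neq0.
  apply: contraNneq => ->.
  by rewrite subrr powR_eq0 euclid_norm_eq0 eqxx oner_eq0.
by near=> w; rewrite inE negb_or; apply/andP; split; near: w.
Unshelve. all: by end_near. Qed.

End EuclidNorm.

(** * Node indexing, subgrids and local bases *)

Section Cover.
Variables (R : realType) (Nx Ny : nat) (xs : Nx.-tuple R) (ys : Ny.-tuple R).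
Variables (nx ny Mx My : nat) (ix : Mx.-tuple nat) (jy : My.-tuple nat).
Variable mu : R.
Implicit Types (k : 'I_(Mx * My)) (lam : 'I_(Nx * Ny)) (z w : R * R).

Local Notation grid := (grid xs ys).
Local Notation node := (node xs ys).
Local Notation local_x := (local_x xs (My := My) ix).
Local Notation local_y := (local_y ys (Mx := Mx) jy).
Local Notation subgrid := (subgrid xs ys nx ny ix jy).
Local Notation local_basis := (local_basis xs ys nx ny ix jy).
Local Notation omega := (omega xs ys nx ny ix jy mu).
Local Notation weight := (weight xs ys nx ny ix jy mu).

Hypotheses (xs_incr : sorted <%R xs) (ys_incr : sorted <%R ys).
Hypothesis ix_fits :
  forall p : nat, (p < Mx)%N -> (nth 0%N ix p + nx <= Nx)%N.
Hypothesis jy_fits :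
  forall q : nat, (q < My)%N -> (nth 0%N jy q + ny <= Ny)%N.
Hypothesis mu_gt0 : 0 < mu.

Lemma node_mod_lt lam : (lam %% Ny < Ny)%N.
(* For [Ny = 0] the index type of [lam] is empty. *)
Proof. by rewrite ltn_mod; case: Ny lam => // -[]; rewrite muln0. Qed.

Lemma node_div_lt lam : (lam %/ Ny < Nx)%N.
Proof. by rewrite ltn_divLR //; apply: leq_ltn_trans (node_mod_lt lam). Qed.

Lemma node_grid lam : node lam \in grid.
Proof.
apply: (allpairs_f pair); rewrite mem_nth // size_tuple.
  exact: node_div_lt.
exact: node_mod_lt.
Qed.

Lemma node_inj : injective node.
Proof.
move=> lam lam' [/eqP + /eqP]; rewrite !nth_uniq ?size_tuple ?lt_sorted_uniq //;
  rewrite ?node_div_lt ?node_mod_lt //.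
move=> /eqP eq_div /eqP eq_mod; apply/val_inj => /=.
by rewrite (divn_eq lam Ny) (divn_eq lam' Ny) eq_div eq_mod.
Qed.

Lemma local_x_inj k : {in [pred r | (r < nx)%N] &, injective (local_x k)}.
Proof.
have k_lt : (k %/ My < Mx)%N.
  by rewrite ltn_divLR //; case: My k => // -[]; rewrite muln0.
have lt_Nx r : (r < nx)%N -> (nth 0%N ix (k %/ My) + r < size xs)%N.
  by move=> ?; rewrite size_tuple (leq_trans _ (ix_fits k_lt)) // ltn_add2l.
move=> r s /lt_Nx r_lt /lt_Nx s_lt /eqP.
by rewrite nth_uniq ?lt_sorted_uniq // => /eqP /addnI.
Qed.

Lemma local_y_inj k : {in [pred s | (s < ny)%N] &, injective (local_y k)}.
Proof.
have k_lt : (k %% My < My)%N.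
  by rewrite ltn_mod; case: My k => // -[]; rewrite muln0.
have lt_Ny r : (r < ny)%N -> (nth 0%N jy (k %% My) + r < size ys)%N.
  by move=> ?; rewrite size_tuple (leq_trans _ (jy_fits k_lt)) // ltn_add2l.
move=> r s /lt_Ny r_lt /lt_Ny s_lt /eqP.
by rewrite nth_uniq ?lt_sorted_uniq // => /eqP /addnI.
Qed.

Lemma grid_uniq : uniq grid.
Proof.
by apply: allpairs_uniq; rewrite ?lt_sorted_uniq // => -[? ?] [? ?] _ _ [-> ->].
Qed.

Lemma subgrid_uniq k : uniq (subgrid k).
Proof.
apply: allpairs_uniq => [||[? ?] [? ?] _ _ [-> ->] //].
  exact/mkseq_uniqP/local_x_inj.
exact/mkseq_uniqP/local_y_inj.
Qed.

Lemma mem_subgridP k z :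
  reflect (exists rs : 'I_nx * 'I_ny, z = (local_x k rs.1, local_y k rs.2))
          (z \in subgrid k).
Proof.
apply: (iffP allpairsP) => [[_ [/mapP[r + ->] /mapP[s + ->] ->]]|[[r s] ->]].
  by rewrite !mem_iota => r_lt s_lt; exists (Ordinal r_lt, Ordinal s_lt).
exists (local_x k r, local_y k s); split=> //=;
  by apply: map_f; rewrite mem_iota /=.
Qed.

(** The value is a product of two one-dimensional Kronecker deltas. Injectivity of the local
    coordinates and of [node] identifies it with equality of the global indices, whichever pair
    [pick] returns. *)
Lemma local_basis_node k lam lam' :
  node lam \in subgrid k -> node lam' \in subgrid k ->
  local_basis k lam (node lam') = (lam == lam')%:R.
Proof.
move=> /mem_subgridP[rs lamE] /mem_subgridP[[r' s'] lam'E].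
rewrite /Defs.local_basis.
case: pickP => [[r s] /= /eqP lamE'|/(_ rs)]; last by rewrite lamE eqxx.
rewrite -(inj_eq node_inj) lamE' lam'E /= xpair_eqE; case: lam'E => -> ->.
rewrite (lagrange_sample_in (@local_x_inj k)).
rewrite (lagrange_sample_in (@local_y_inj k)).
rewrite -natrM mulnb (inj_in_eq (@local_x_inj k)) ?inE ?ltn_ord //.
by rewrite (inj_in_eq (@local_y_inj k)) ?inE ?ltn_ord.
Qed.

(** * Closed form of the weights and their values at the nodes *)

Hypothesis subgrid_sub : forall k, {subset subgrid k <= grid}.

(* The numerator in the closed form of the weights: it has no poles. *)
Definition weight_numerator k z : R :=
  \prod_(w <- grid | w \notin subgrid k) euclid_norm (z - w) `^ mu.

Lemma omegaE k z :
  z \notin grid ->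
  omega k z =
  weight_numerator k z * \prod_(w <- grid) euclid_norm (z - w) `^ (- mu).
Proof.
(* The full product is split along [subgrid k]: outside it the exponents [mu] and [- mu] cancel, and
   the inner part is [omega k z] up to the order of the factors. *)
move=> z_grid; rewrite (bigID (mem (subgrid k)) predT) /= mulrCA -big_split /=.
rewrite [X in _ * X]big_seq_cond.
rewrite [X in _ * X]big1 ?mulr1 => [|w /andP[w_grid _]].
  rewrite -big_filter; apply/perm_big/uniq_perm.
  - exact: subgrid_uniq.
  - exact/filter_uniq/grid_uniq.
  move=> w; rewrite mem_filter.
  by case: (boolP (w \in _)) => // /subgrid_sub ->.
rewrite powRN divff // euclid_dist_powR_neq0 //.
by apply: contraNneq z_grid => ->.
Qed.

Lemma weight_numerator_ge0 k z : 0 <= weight_numerator k z.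
Proof. by apply: prodr_ge0 => w _; exact: powR_ge0. Qed.

(** Only the factor indexed by [z] itself can vanish, and it is present exactly when [z] lies
    outside the subgrid; it does vanish because [mu] is positive. *)
Lemma weight_numerator_eq0 k z :
  z \in grid -> (weight_numerator k z == 0) = (z \notin subgrid k).
Proof.
move=> z_grid; rewrite prodf_seq_eq0; apply/hasP/idP => [[w _ /andP[wk]]|zk].
  apply: contraL => zk; apply: euclid_dist_powR_neq0.
  by apply: contraNneq wk => <-.
by exists z => //; rewrite zk /= subrr powR_eq0 euclid_norm_eq0 eqxx gt_eqF.
Qed.

Lemma weight_numerator_continuous k : continuous (weight_numerator k).
Proof.
apply: continuous_big; first exact: mul_continuous.
by move=> w _; exact: euclid_dist_powR_continuous.
Qed.

Hypothesis grid_sub :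
  forall z, z \in grid -> exists k, z \in subgrid k.

Lemma sum_weight_numerator_gt0 z :
  z \in grid -> 0 < \sum_(l < Mx * My) weight_numerator l z.
Proof.
move=> z_grid; have [k zk] := grid_sub z_grid.
rewrite (bigD1 k) //= ltr_pwDl // ?sumr_ge0 // => [|l _].
  by rewrite lt_def weight_numerator_ge0 weight_numerator_eq0 // zk.
exact: weight_numerator_ge0.
Qed.

Lemma weight_grid k z :
  z \in grid ->
  weight k z = weight_numerator k z / \sum_(l < Mx * My) weight_numerator l z.
Proof.
move=> z_grid; rewrite /Defs.weight z_grid.
apply: cvg_lim; [exact: norm_hausdorff|exact: dnbhs_pair_proper_filter|].
pose ratio w := weight_numerator k w / \sum_(l < Mx * My) weight_numerator l w.
have ratio_cvg : ratio w @[w --> z] --> ratio z.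
  apply: cvgM; first exact: weight_numerator_continuous.
  apply: cvgV; first by rewrite gt_eqF // sum_weight_numerator_gt0.
  apply: cvg_big; first exact: add_continuous.
  by move=> l _; exact: weight_numerator_continuous.
have : ratio w @[w --> z^'] --> ratio z.
  exact: cvg_trans (cvg_fmap2 (@nbhs_dnbhs _ z)) ratio_cvg.
apply: cvg_trans; apply: near_eq_cvg.
near=> w; rewrite /Defs.omega_ratio /ratio.
have w_grid : w \notin grid by near: w; exact: near_dnbhs_notin.
(* The factor common to numerator and denominator does not depend on the subgrid and is nonzero off
   the grid, so it cancels. *)
rewrite omegaE // (eq_bigr _ (fun l _ => omegaE l w_grid)) -mulr_suml.
rewrite -mulf_div divff ?mulr1 // prodf_seq_neq0; apply/allP => y y_grid /=.
by apply: euclid_dist_powR_neq0; apply: contraNneq w_grid => ->.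
Unshelve. all: by end_near. Qed.

Lemma weight_node_eq0 k z : z \in grid -> z \notin subgrid k -> weight k z = 0.
Proof.
move=> z_grid; rewrite -weight_numerator_eq0 // weight_grid // => /eqP ->.
by rewrite mul0r.
Qed.

Lemma sum_weight z : z \in grid -> \sum_(k < Mx * My) weight k z = 1.
Proof.
move=> z_grid; rewrite (eq_bigr _ (fun k _ => weight_grid k z_grid)) -mulr_suml.
by rewrite divff // gt_eqF // sum_weight_numerator_gt0.
Qed.

Lemma global_basis_node (lam lam' : 'I_(Nx * Ny)) :
  global_basis xs ys nx ny ix jy mu lam (node lam') = (lam == lam')%:R.
Proof.
have z_grid := node_grid lam'.
have [<-|neq] := eqVneq lam lam'.
  (* The sum over subgrids containing the node extends to all subgrids, as the remaining weights
     vanish there. *)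
  rewrite -(sum_weight (node_grid lam)) /global_basis big_mkcond /=.
  apply: eq_bigr => k _; case: ifPn => lam_k.
    by rewrite local_basis_node // eqxx mul1r.
  by rewrite weight_node_eq0 ?node_grid.
(* Each term vanishes: through the local basis if subgrid [k] contains both nodes, through the
   weight if it misses [node lam']. *)
apply: big1 => k lam_k; have [lam'_k|lam'_k] := boolP (node lam' \in subgrid k).
  by rewrite local_basis_node // (negPf neq) mul0r.
by rewrite weight_node_eq0 ?mulr0.
Qed.

End Cover.

Theorem proposition2 (R : realType) (a b c d : R)
  (Nx Ny : nat) (xs : Nx.-tuple R) (ys : Ny.-tuple R)
  (xs_incr : sorted <%R xs) (xs_first : xs`_0 = a) (xs_last : xs`_Nx.-1 = b)
  (ys_incr : sorted <%R ys) (ys_first : ys`_0 = c) (ys_last : ys`_Ny.-1 = d)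
  (nx ny rhox rhoy : nat)
  (nx_bounds : (2 <= nx <= Nx)%N) (ny_bounds : (2 <= ny <= Ny)%N)
  (rhox_bounds : (1 <= rhox <= nx - 1)%N)
  (rhoy_bounds : (1 <= rhoy <= ny - 1)%N)
  (Mx My : nat) (ix : Mx.-tuple nat) (jy : My.-tuple nat)
  (ix_step : forall p : nat, (p.+1 < Mx)%N ->
     nth 0%N ix p.+1 = (nth 0%N ix p + rhox)%N)
  (jy_step : forall q : nat, (q.+1 < My)%N ->
     nth 0%N jy q.+1 = (nth 0%N jy q + rhoy)%N)
  (ix_fits : forall p : nat, (p < Mx)%N -> (nth 0%N ix p + nx <= Nx)%N)
  (jy_fits : forall q : nat, (q < My)%N -> (nth 0%N jy q + ny <= Ny)%N)
  (covering : forall z : R * R,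
     (z \in grid xs ys) <->
     exists k : 'I_(Mx * My), z \in subgrid xs ys nx ny ix jy k)
  (mu : R) (mu_gt2 : 2 < mu) :
  (forall i j : 'I_(Nx * Ny),
     global_basis xs ys nx ny ix jy mu i (node xs ys j) = (i == j)%:R) /\
  (forall (u : R * R -> R) (j : 'I_(Nx * Ny)),
     global_operator xs ys nx ny ix jy mu u (node xs ys j) = u (node xs ys j)).
Proof.
have cardinal (i j : 'I_(Nx * Ny)) :
    global_basis xs ys nx ny ix jy mu i (node xs ys j) = (i == j)%:R.
  apply: global_basis_node => //.
  - exact: lt_trans mu_gt2.
  (* The two directions of [covering] give the inclusion of each subgrid in the grid and the
     existence of a subgrid through each node. *)
  - by move=> k z zk; apply/covering; exists k.
  - by move=> z /covering.
split=> // u j; rewrite /global_operator (bigD1 j) //= cardinal eqxx mulr1.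
by rewrite big1 ?addr0 // => i /negPf ij; rewrite cardinal ij mulr0.
Qed.
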